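(* Consider a stationary VLMC $(U_n)_{n\ge0}$ defined by a probabilized infinite comb, with stationary probability measure $\pi$ and process of final letters $X=(X_n)_{n\ge0}$. Let $w=w_1\cdots w_k$ be a word of length $k\ge1$ such that $\overline w$ is not an internal node of the comb. Then, for $|x|<1$, the generating function of the position of the first occurrence of $w$ in $X$ is $$\Phi_w^{(1)}(x)=\frac{x^k\pi(w)}{(1-x)S_w(x)}$$ and, for every $r\ge1$, the generating function of the position of the $r$-th occurrence is $$\Phi_w^{(r)}(x)=\Phi_w^{(1)}(x)\left(1-\frac1{S_w(x)}\right)^{r-1},$$ where $$S_w(x)=C_w(x)+\sum_{j=k}^{\infty}q^{(j)}_{\mathrm{pref}(w)}(w)\,x^j,$$ $$C_w(x)=1+\sum_{j=1}^{k-1}\mathbf 1_{\{w_{j+1}\cdots w_k=w_1\cdots w_{k-j}\}}\,q^{(j)}_{\mathrm{pref}(w)}(w_{k-j+1}\cdots w_k)\,x^j.$$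
   Context: **Words.** $\mathcal A=\{0,1\}$; $\mathcal L=\mathcal A^{-\mathbb N}$ is the set of left-infinite sequences $\cdots\alpha_{-1}\alpha_0$, with the $\sigma$-algebra generated by the cylinders $\mathcal Lw=\{s\in\mathcal L:\ w\text{ is a suffix of }s\}$, $w$ a finite word. $\overline w$ is the reversed word of $w$; for $s=\cdots\alpha_{-1}\alpha_0\in\mathcal L$, $\overline s=\alpha_0\alpha_{-1}\cdots$. Notation: $\pi(w):=\pi(\mathcal Lw)$; $|u|$ is the length of $u$. **Infinite comb.** It is the tree $\mathcal T=\{0^n:n\ge0\}\cup\{0^n1:n\ge0\}$. Its internal nodes are the words $0^n$, $n\ge0$; its leaves (contexts) are the finite words $0^n1$, $n\ge0$, and the infinite word $0^\infty$. To each context $c$ is attached a probability measure $q_c$ on $\mathcal A$. **VLMC.** For $s\in\mathcal L$, $\mathrm{pref}(s)$ is the unique context that is a prefix of $\overline s$ (or equals $\overline s$). The VLMC is the $\mathcal L$-valued Markov chain $(U_n)$ with transitions $\mathbf P(U_{n+1}=U_n\alpha\mid U_n)=q_{\mathrm{pref}(U_n)}(\alpha)$; it is stationary when $U_0$ has a stationary distribution $\pi$. $X_n$ is the last letter of $U_n$; for indices $m\le0$, $X_m$ denotes the corresponding letter of $U_0=\cdots X_{-1}X_0$. For a finite word $w$ such that $\overline w$ is not an internal node, $\mathrm{pref}(w)$ is the unique finite context $c$ such that $\overline c$ is a suffix of $w$. **Occurrences.** $w$ of length $k$ occurs at position $n\ge k$ if $X_{n-k+1}\cdots X_n=w$. $T_w^{(r)}$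 is the position of the $r$-th occurrence of $w$ (possibly $+\infty$) and $\Phi_w^{(r)}(x)=\sum_{n\ge0}\mathbf P(T_w^{(r)}=n)x^n$. **Notation $q_c^{(n)}(u)$.** For a finite word $u$, a finite context $c$ and $n\ge0$, $q_c^{(n)}(u)=\mathbf P\left(X_{n-|u|+1}\cdots X_n=u\mid X_{-(|c|-1)}\cdots X_0=\overline c\right)$ (the conditional probability being assumed to be well defined). *)

(* Defs.v *)
From HB Require Import structures.
From mathcomp Require Import all_boot all_order all_algebra.
From mathcomp Require Import all_classical all_reals all_analysis.
From mathcomp Require Import complex.

Set Implicit Arguments.
Unset Strict Implicit.
Unset Printing Implicit Defensive.

Import Order.TTheory GRing.Theory Num.Theory.
Import numFieldNormedType.Exports.

Local Open Scope classical_set_scope.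
Local Open Scope ring_scope.

(* The alphabet {0, 1} is [bool], with 0 = false and 1 = true; finite words
   are [seq bool]. *)

(* A left-infinite sequence s = ... a_(-1) a_0 is encoded by its reversal
   a_0 a_(-1) ..., i.e. by the function i |-> a_(-i). *)
Definition lseq := nat -> bool.

(* [mkseq s n] = a_0 a_(-1) ... a_(-n+1), hence the reversal of [w]. *)
Definition cylinder (w : seq bool) : set lseq :=
  [set s | mkseq s (size w) = rev w].

Definition cylinders : set (set lseq) := range cylinder.

Notation L := (g_sigma_algebraType cylinders).

Definition append (s : L) (a : bool) : L :=
  fun i => if i is j.+1 then s j else a.

(* The infinite comb: internal nodes 0^n, leaves 0^n 1 and 0^oo. *)
Definition internal_node (u : seq bool) : Prop := exists n, u = nseq n false.

Definition leaf (n : nat) : seq bool := rcons (nseq n false) true.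

(* [Some n] stands for the finite context 0^n 1, [None] for 0^oo. *)
Definition context := option nat.

Definition context_prefix (c : context) (s : L) : Prop :=
  match c with
  | Some n => mkseq s (size (leaf n)) = leaf n
  | None => s = (fun=> false)
  end.

(* the unique context satisfying [context_prefix], see [prefP], [pref_uniq] *)
Definition pref (s : L) : context := xget None [set c | context_prefix c s].

(* The unique n such that the reversal of 0^n 1 is a suffix of w, see
   [prefwP], [prefw_uniq]; only relevant when w contains the letter 1. *)
Definition prefw (w : seq bool) : nat :=
  xget 0%N [set n | suffix (rev (leaf n)) w].

(* \sum_(m <= j < oo) a_j; [R[i]^o] is R[i] equipped with the topology induced
   by the complex modulus *)
Definition sum_from (R : realType) (m : nat) (a : nat -> R[i]) : R[i] :=
  \big[+%R/0]_(m <= j <oo) (a j : R[i]^o).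

Section VLMC.
Context (R : realType).
Variable q : context -> probability bool R.

Definition vlmc_kernel (s : L) (B : set L) : \bar R :=
  (\sum_(a : bool) q (pref s) [set a] * \d_(append s a) B)%E.

Definition stationary_measure (pi : probability L R) : Prop :=
  forall B : set L, measurable B ->
    pi B = (\int[pi]_s vlmc_kernel s B)%E.

Context (d : measure_display) (Omega : measurableType d).
Variables (P : probability Omega R) (U : nat -> {RV P >-> L}).

(* sigma(U_0, ..., U_n) *)
Definition natural_filtration (n : nat) : set (set Omega) :=
  <<s \bigcup_(m in `I_n.+1) preimage_set_system setT (U m) measurable >>.

(* P (U_(n+1) \in B | U_0, ..., U_n) = vlmc_kernel (U_n) B *)
Definition is_vlmc : Prop :=
  forall (n : nat) (E : set Omega) (B : set L),
    natural_filtration n E -> measurable B ->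
    P (E `&` U n.+1 @^-1` B) = (\int[P]_(o in E) vlmc_kernel (U n o) B)%E.

Definition stationary_vlmc (pi : probability L R) : Prop :=
  [/\ is_vlmc, stationary_measure pi &
      forall B : set L, measurable B -> distribution P (U 0%N) B = pi B].

(* X_m, the last letter of U_m if m >= 0, read off U_0 if m <= 0; note that
   Negz m = - m.+1 *)
Definition letter (m : int) (o : Omega) : bool :=
  match m with
  | Posz n => U n o 0%N
  | Negz n => U 0%N o n.+1
  end.

(* X_(n-|u|+1) ... X_n = u *)
Definition reads (u : seq bool) (n : int) (o : Omega) : Prop :=
  mkseq (fun i => letter (n - (size u)%:Z + 1 + i%:Z) o) (size u) = u.

Definition occurs (w : seq bool) (n : nat) (o : Omega) : Prop :=
  (size w <= n)%N /\ reads w n%:Z o.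

Definition nb_occ (w : seq bool) (n : nat) (o : Omega) : nat :=
  (\sum_(m < n.+1) `[< occurs w m o >])%N.

(* T_w^(r) for r >= 1, with None for +oo *)
Definition position (w : seq bool) (r : nat) (o : Omega) : option nat :=
  xget None [set Some n | n in [set n | occurs w n o /\ nb_occ w n o = r]].

Definition Phi (w : seq bool) (r : nat) (x : R[i]) : R[i] :=
  sum_from 0 (fun n => (fine (P [set o | position w r o = Some n]))%:C%C * x ^+ n).

(* q_c^(n)(u), the number [c] standing for the context 0^c 1; meaningful when
   the conditioning event has positive probability *)
Definition qn (c : nat) (n : nat) (u : seq bool) : R :=
  fine (P [set o | reads u n%:Z o /\ reads (rev (leaf c)) 0 o]) /
  fine (P [set o | reads (rev (leaf c)) 0 o]).

Definition Cw (w : seq bool) (x : R[i]) : R[i] :=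
  let k := size w in
  1 + \sum_(1 <= j < k)
        (drop j w == take (k - j)%N w)%:R
        * (qn (prefw w) j (drop (k - j)%N w))%:C%C * x ^+ j.

Definition Sw (w : seq bool) (x : R[i]) : R[i] :=
  Cw w x
  + sum_from (size w) (fun j => (qn (prefw w) j w)%:C%C * x ^+ j).

End VLMC.

Lemma leaf_mkseq n (s : L) :
  (mkseq s (size (leaf n)) = leaf n) <->
  (s n = true /\ forall i, (i < n)%N -> s i = false).
Proof.
have sz : size (leaf n) = n.+1 by rewrite /leaf size_rcons size_nseq.
split=> [H|[sn s0]].
  have E i : (i < n.+1)%N -> s i = nth false (leaf n) i.
    by move=> lti; rewrite -H nth_mkseq // sz.
  split=> [|i lti]; first by rewrite E // nth_rcons size_nseq ltnn eqxx.
  by rewrite E ?(leqW lti)// nth_rcons size_nseq lti nth_nseq lti.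
apply: (@eq_from_nth _ false) => [|i]; rewrite size_mkseq // sz => lti.
rewrite nth_mkseq ?sz // nth_rcons size_nseq nth_nseq.
move: lti; rewrite ltnS leq_eqVlt => /orP[/eqP->|lti]; first by rewrite ltnn eqxx.
by rewrite lti s0.
Qed.

Lemma context_prefix_uniq s c c' :
  context_prefix c s -> context_prefix c' s -> c = c'.
Proof.
case: c c' => [n|] [m|] //=; rewrite ?leaf_mkseq.
- move=> [sn s0] [sm s1]; congr Some.
  by case: (ltngtP n m) => [/s1|/s0|//]; rewrite ?sn ?sm.
- by move=> [sn _] E; rewrite E in sn.
- by move=> E [sn _]; rewrite E in sn.
Qed.

Lemma prefP s : context_prefix (pref s) s.
Proof.
rewrite /pref; case: xgetP => [c _ //|H].
have [[n sn]|N] := pselect (exists n, s n).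
  exfalso; pose m := ex_minn (ex_intro _ n sn).
  apply: (H (Some m)) => /=; rewrite leaf_mkseq /m.
  case: ex_minnP => k sk kmin; split=> // i lti.
  by apply/negP => /kmin; rewrite leqNgt lti.
by apply/funext => n; apply/negP => sn; apply: N; exists n.
Qed.

Lemma pref_uniq s c : context_prefix c s -> pref s = c.
Proof. exact: context_prefix_uniq (prefP s). Qed.

Lemma suffix_leafE w n :
  suffix (rev (leaf n)) w -> index true (rev w) = n.
Proof.
rewrite -prefix_rev revK => /prefixP[v ->].
rewrite /leaf cat_rcons index_cat mem_nseq andbF size_nseq /=.
by rewrite addn0.
Qed.

Lemma prefw_uniq w n : suffix (rev (leaf n)) w -> prefw w = n.
Proof.
rewrite /prefw => sn; case: xgetP => [m _ /suffix_leafE <-|/(_ n)//].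
exact: suffix_leafE.
Qed.

Lemma prefwP w :
  ~ internal_node (rev w) -> suffix (rev (leaf (prefw w))) w.
Proof.
move=> Nw; suff [n sn] : exists n, suffix (rev (leaf n)) w.
  by rewrite (prefw_uniq sn).
have : ~ exists n, rev w = nseq n false by [].
rewrite -{-1}(revK w); elim: (rev w) => [|[] v IH] {}Nw.
- by case: Nw; exists 0%N.
- exists 0%N; rewrite -prefix_rev !revK.
  by rewrite /leaf /= prefix0s.
- have [|n] := IH; first by move=> [n vn]; apply: Nw; exists n.+1; rewrite vn.
  by rewrite -prefix_rev !revK => vn; exists n.+1; rewrite -prefix_rev !revK.
Qed.

(* Main.v *)
Require Import Defs.
From mathcomp Require Import all_boot all_order all_algebra.
From mathcomp Require Import all_classical all_reals all_analysis.
From mathcomp Require Import measurable_realfun complex.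
From mathcomp Require Import ring lra zify.
Import Order.TTheory GRing.Theory Num.Theory.
Import numFieldNormedType.Exports.
Local Open Scope classical_set_scope.
Local Open Scope ring_scope.

Set Implicit Arguments.
Unset Strict Implicit.
Unset Printing Implicit Defensive.

(** The occurrences of [w] form a renewal process.  Since [rev w] is not an
    internal node, [w] ends with [rev (leaf c)] for [c = prefw w]: as soon as
    [w] has been read, the current context is [leaf c], whatever came before.
    Hence an event [E] that is known at time [m] and contained in
    { w occurs at m } is independent of a later occurrence in the sense that
      P (E, w occurs at m + j) = P (E) s_j,
    where [s_j] does not depend on [E] nor on [m] ([return_probE]).  If
    [j >= k = size w], the two occurrences do not overlap and
    [s_j = q_c^(j)(w)]; if [0 < j < k], then [w] must overlap itself with shift
    [j], and only its last [j] letters remain to be read.  The numbers [s_j] are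
    therefore the coefficients of [Sw] ([Sw_return]).

    Applied to E = { T_w^(r) = m } and summed over [m <= n], this gives
      sum_(m <= n) P (T_w^(r) = m) s_(n - m)
        = P (w occurs at n, T_w^(r) <= n)   ([renewal]).
    For [r = 1] the right-hand side is the probability that [w] occurs at [n],
    namely [pi (cylinder w)] if [n >= k] and 0 otherwise, by stationarity.
    Taking Cauchy products of power series, [Phi_1 S = x^k pi(w) / (1 - x)].
    For a general [r], the right-hand side is P (T_w^(r) = n) plus the same
    quantity for [r + 1], so that [Phi_r S = Phi_r + Phi_(r+1) S].

    The formulas divide by [S].  If [x != 0] and [pi(w) != 0], [S] does not
    vanish because [Phi_1 S] does not.  If [x = 0], [S] is its constant term 1.
    If [pi(w) = 0], all [s_j] with [j > 0] vanish: a shift [j < k] with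
    [s_j > 0] would make it possible to read the last [j] letters of [w] again
    and again from the context [leaf c], hence to read [w] ([overlap_gt0]).

    The Markov property of the hypothesis is about conditional laws, so the
    identity [U_(n+1) = U_n a], on which everything above relies, holds only
    almost surely; [coherent] is the event that it holds at all times. *)

(** * Complex power series with coefficients in the unit interval *)

Section power_series.
Variable R : realType.
Implicit Types (x z : R[i]) (a u v : nat -> R).

Lemma gt0_complexE (e : R[i]) : 0 < e -> exists2 r : R, 0 < r & e = r%:C%C.
Proof.
move=> e0; exists (complex.Re e); last by rewrite RRe_real// gtr0_real.
by rewrite -ltcR RRe_real// gtr0_real.
Qed.

Lemma cvg_complex (f : nat -> R) (l : R) : f @ \oo --> l ->
  (fun n => (f n)%:C%C : R[i]^o) @ \oo --> (l%:C%C : R[i]^o).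
Proof.
move=> /cvgrPdist_le fl; apply/cvgrPdist_le => e /gt0_complexE[r r0 ->].
near=> n; rewrite -rmorphB normc_def /= expr0n addr0 sqrtr_sqr lecR.
by near: n; exact: fl.
Unshelve. all: by end_near. Qed.

Lemma norm_complexE x : `|x| = (complex.Re `|x|)%:C%C.
Proof. by rewrite normc_def. Qed.

Lemma norm_Im_le x : `|complex.Im x| <= complex.Re `|x|.
Proof.
by rewrite normc_def /= -sqrtr_sqr ler_sqrt ?lerDr ?addr_ge0 ?sqr_ge0.
Qed.

Lemma norm_Re_le x : `|complex.Re x| <= complex.Re `|x|.
Proof. by rewrite -lecR -norm_complexE normc_ge_Re. Qed.

Lemma Re_normX x n : complex.Re `|x ^+ n| = complex.Re `|x| ^+ n.
Proof.
apply: (@complexI R).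
by rewrite rmorphXn /= -!norm_complexE normrX.
Qed.

Lemma Re_norm_ge0 x : 0 <= complex.Re `|x|.
Proof. by rewrite (le_trans _ (norm_Re_le x)). Qed.

Lemma Re_norm_lt1 x : `|x| < 1 -> complex.Re `|x| < 1.
Proof. by rewrite {1}norm_complexE -[1]/(1%:C%C) ltcR. Qed.

Lemma is_cvg_bounded_mul_geometric (f : nat -> R) (r : R) :
  0 <= r < 1 -> (forall n, `|f n| <= r ^+ n) ->
  cvgn (series f).
Proof.
move=> /andP[r0 r1] fr; apply: normed_cvg.
apply: (@series_le_cvg _ _ (geometric 1 r)).
- by move=> n; rewrite /= normr_ge0.
- by move=> n; rewrite /= mul1r exprn_ge0.
- by move=> n; rewrite /= mul1r.
- by apply: is_cvg_geometric_series; rewrite ger0_norm.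
Qed.

Definition psum a x (n : nat) : R[i] := \sum_(0 <= j < n) (a j)%:C%C * x ^+ j.

(** The real and imaginary parts are real series dominated by a geometric one,
    which reduces the convergence to the completeness of the reals. *)
Lemma is_cvg_psum a x : (forall n, 0 <= a n <= 1) -> `|x| < 1 ->
  cvgn (psum a x : nat -> R[i]^o).
Proof.
move=> a01 x1; set r := complex.Re `|x|.
have r01 : 0 <= r < 1 by rewrite Re_norm_ge0 Re_norm_lt1.
have an n : `|a n| <= 1 by case/andP: (a01 n) => a0 a1; rewrite ger0_norm.
pose fr n := a n * complex.Re (x ^+ n); pose fi n := a n * complex.Im (x ^+ n).
have frl n : `|fr n| <= r ^+ n.
  by rewrite normrM -[leRHS]mul1r ler_pM// -Re_normX norm_Re_le.
have fil n : `|fi n| <= r ^+ n.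
  by rewrite normrM -[leRHS]mul1r ler_pM// -Re_normX norm_Im_le.
have /cvg_complex cr := is_cvg_bounded_mul_geometric r01 frl.
have /cvg_complex ci := is_cvg_bounded_mul_geometric r01 fil.
have -> : psum a x = (fun n => ((series fr n)%:C%C : R[i]^o)
    + 'i%C * ((series fi n)%:C%C : R[i]^o)).
  apply/funext => n; rewrite /psum /series /= !rmorph_sum /= mulr_sumr -big_split.
  apply: eq_bigr => j _ /=.
  by rewrite [in LHS](complexE (x ^+ j)) mulrDr /fr /fi !rmorphM /= mulrCA.
apply/cvg_ex; eexists; apply: cvgD; first exact: cr.
by apply: cvgM; [exact: cvg_cst|exact: ci].
Qed.

Lemma sum_fromE (b : nat -> R[i]) m (l : R[i]) :
  (fun n => \sum_(m <= j < n) b j : R[i]^o) @ \oo --> (l : R[i]^o) ->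
  sum_from m b = l.
Proof.
by move=> bl; apply: (@cvg_lim R[i]^o _ _ _ _ _ _ bl); exact: norm_hausdorff.
Qed.

Lemma eq_sum_from m (b b' : nat -> R[i]) :
  (forall j, (m <= j)%N -> b j = b' j) -> sum_from m b = sum_from m b'.
Proof.
move=> bb'; rewrite /sum_from (_ : (fun n => \sum_(m <= j < n) (b j : R[i]^o)) =
  (fun n => \sum_(m <= j < n) (b' j : R[i]^o)))//.
by apply/funext => n; apply: eq_big_nat => j /andP[mj _]; exact: bb'.
Qed.

Lemma cvg_sum_from0 a x : (forall n, 0 <= a n <= 1) -> `|x| < 1 ->
  (psum a x : nat -> R[i]^o) @ \oo -->
  (sum_from 0 (fun n => (a n)%:C%C * x ^+ n) : R[i]^o).
Proof. by move=> a01 x1; have := is_cvg_psum a01 x1. Qed.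

Lemma sum_from_split a x k : (forall n, 0 <= a n <= 1) -> `|x| < 1 ->
  sum_from 0 (fun n => (a n)%:C%C * x ^+ n) =
  \sum_(0 <= j < k) (a j)%:C%C * x ^+ j
  + sum_from k (fun n => (a n)%:C%C * x ^+ n).
Proof.
move=> a01 x1; apply/eqP; rewrite addrC -subr_eq; apply/eqP/esym.
apply: sum_fromE.
apply: (cvg_trans _ (cvgB (cvg_sum_from0 a01 x1) (cvg_cst
   (\sum_(0 <= j < k) (a j)%:C%C * x ^+ j : R[i]^o)))).
apply: near_eq_cvg; near=> n.
rewrite /psum !fctE (@big_cat_nat _ _ _ k)//=; first by rewrite addrC addKr.
by near: n; exact: nbhs_infty_ge.
Unshelve. all: by end_near. Qed.

(** Exchange of summation over the triangle [i + j < N]. *)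
Lemma triangle_sum (V : zmodType) (F : nat -> nat -> V) N :
  \sum_(n < N) \sum_(i < n.+1) F i (n - i)%N =
  \sum_(i < N) \sum_(j < N - i) F i j.
Proof.
elim: N => [|N IH]; first by rewrite !big_ord0.
rewrite big_ord_recr IH [in RHS]big_ord_recr /= subSnn big_ord1.
rewrite [X in _ + X = _]big_ord_recr /= subnn addrA -big_split /=; congr (_ + _).
by apply: eq_bigr => i _; rewrite subSn 1?ltnW// big_ord_recr.
Qed.

(** With [r = s ^+ 4], the sequence [n * s ^+ n] is bounded because it is at
    most the sum of the [s ^+ i], and what remains is the square of this bound
    times [(s ^+ 2) ^+ n]. *)
Lemma cvg_sqr_mul_geometric (r : R) : 0 <= r < 1 ->
  (fun n => n%:R ^+ 2 * r ^+ n) @ \oo --> (0 : R).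
Proof.
move=> /andP[r0 r1]; pose s := Num.sqrt (Num.sqrt r).
have s0 : 0 <= s by rewrite sqrtr_ge0.
have s2 : s ^+ 2 = Num.sqrt r by rewrite sqr_sqrtr// sqrtr_ge0.
have s4 : r = (s ^+ 2) ^+ 2 by rewrite s2 sqr_sqrtr.
have s21 : s ^+ 2 < 1.
  by rewrite -(@ltr_pXn2r _ 2) ?nnegrE ?ler01 ?exprn_ge0// -s4 expr1n.
have s1 : s < 1 by rewrite -(@ltr_pXn2r _ 2) ?nnegrE ?ler01// expr1n.
have ns n : n%:R * s ^+ n <= (1 - s)^-1.
  apply: (@le_trans _ _ (\sum_(i < n) s ^+ i)).
    have -> : n%:R * s ^+ n = \sum_(i < n) s ^+ n.
      by rewrite sumr_const card_ord mulr_natl.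
    apply: ler_sum => i _; apply: ler_wiXn2l => //; first exact: ltW.
    exact: ltnW.
  rewrite -[leRHS]mul1r ler_pdivlMr ?subr_gt0//.
  have := subrX1 s n; have : 0 <= s ^+ n by rewrite exprn_ge0.
  by move: (s ^+ n) (\sum_(i < n) _) => y z y0 yz; lra.
apply: (@squeeze_cvgr _ _ _ _ (fun=> 0) (geometric ((1 - s)^-1 ^+ 2) (s ^+ 2))).
- near=> n; rewrite mulr_ge0 ?exprn_ge0//= s4.
  have -> : n%:R ^+ 2 * (s ^+ 2 ^+ 2) ^+ n = (n%:R * s ^+ n) ^+ 2 * (s ^+ 2) ^+ n.
    by rewrite [in RHS]exprMn -[RHS]mulrA -!exprM -exprD; congr (_ * s ^+ _); lia.
  by rewrite ler_wpM2r ?exprn_ge0// ler_pXn2r ?nnegrE ?ns ?mulr_ge0 ?exprn_ge0//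
    invr_ge0 subr_ge0 ltW.
- exact: cvg_cst.
- by apply: cvg_geometric; rewrite ger0_norm ?exprn_ge0.
Unshelve. all: by end_near. Qed.

(** The product of the [n]-th partial sums differs from that of the Cauchy
    product by the terms with [i, j < n <= i + j]: there are at most [n ^+ 2]
    of them, each of modulus at most [`|x| ^+ n]. *)
Lemma sum_from_cauchy u v a x :
  (forall n, 0 <= u n <= 1) -> (forall n, 0 <= v n <= 1) -> `|x| < 1 ->
  (forall n, a n = \sum_(i < n.+1) u i * v (n - i)%N) ->
  sum_from 0 (fun n => (a n)%:C%C * x ^+ n) =
  sum_from 0 (fun n => (u n)%:C%C * x ^+ n) *
  sum_from 0 (fun n => (v n)%:C%C * x ^+ n).
Proof.
move=> u01 v01 x1 aE; apply: sum_fromE.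
have r01 : 0 <= complex.Re `|x| < 1 by rewrite Re_norm_ge0 Re_norm_lt1.
pose F i j := (u i)%:C%C * x ^+ i * ((v j)%:C%C * x ^+ j).
(* the part of the square [i, j < n] above its antidiagonal *)
pose tail n := \sum_(i < n) \sum_(n - i <= j < n) F i j.
have E n : psum a x n = psum u x n * psum v x n - tail n.
  rewrite /psum /tail big_mkord.
  under eq_bigr => m _.
    rewrite aE rmorph_sum /= mulr_suml.
    under eq_bigr => i _ do
      rewrite rmorphM /= -[X in x ^+ X](@subnKC i m) -1?ltnS// exprD mulrACA.
    over.
  rewrite (triangle_sum F) !big_mkord mulr_suml -sumrB; apply: eq_bigr => i _.
  rewrite mulr_sumr -(big_mkord xpredT (F i)).
  rewrite [X in _ = X - _](_ : _ = \sum_(0 <= j < n) F i j);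
    last by rewrite big_mkord.
  by rewrite (@big_cat_nat _ _ _ (n - i)%N 0%N n)// ?leq_subr// addrK.
have -> : (fun n => \sum_(0 <= j < n) (a j)%:C%C * x ^+ j : R[i]^o) =
          (fun n => (psum u x n : R[i]^o) * (psum v x n : R[i]^o) - tail n).
  by apply/funext => n; exact: E.
rewrite -[X in _ --> X]subr0; apply: cvgB.
  by apply: cvgM; exact: cvg_sum_from0.
have /cvgrPdist_le T0 := cvg_complex (cvg_sqr_mul_geometric r01).
apply/cvgrPdist_le => e /T0; apply: filterS => n.
rewrite !sub0r !normrN; apply: le_trans.
rewrite [leRHS]ger0_norm; last first.
  by rewrite ler0c mulr_ge0 ?exprn_ge0// Re_norm_ge0.
rewrite rmorphM !rmorphXn /= -norm_complexE rmorph_nat.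
have w1 b : 0 <= b <= 1 -> `|b%:C%C| <= 1 :> R[i].
  by case/andP=> b0 b1; rewrite ger0_norm ?ler0c// -[1]/(1%:C%C) lecR.
rewrite expr2 -mulrA; apply: (@le_trans _ _ (\sum_(i < n) n%:R * `|x| ^+ n)).
  apply: (le_trans (ler_norm_sum _ _ _)); apply: ler_sum => i _.
  apply: (le_trans (ler_norm_sum _ _ _)).
  apply: (@le_trans _ _ (\sum_(n - i <= j < n) `|x| ^+ n)).
    rewrite !big_seq; apply: ler_sum => j.
    rewrite mem_index_iota => /andP[ij jn].
    rewrite !normrM !normrX mulrACA -exprD -[leRHS]mul1r.
    apply: ler_pM; rewrite ?mulr_ge0 ?exprn_ge0//.
      by rewrite -[leRHS]mulr1 ler_pM// w1.
    by apply: ler_wiXn2l; rewrite ?(ltW x1)// -leq_subLR.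
  rewrite sumr_const_nat -[leLHS]mulr_natl ler_wpM2r ?exprn_ge0// ler_nat; lia.
by rewrite sumr_const card_ord -[leLHS]mulr_natl.
Qed.

Lemma sum_from_geometric k (p : R) x : 0 <= p <= 1 -> `|x| < 1 ->
  sum_from 0 (fun n => (if (k <= n)%N then p else 0)%:C%C * x ^+ n) =
  x ^+ k * p%:C%C / (1 - x).
Proof.
move=> p01 x1; have x1' : 1 - x != 0.
  by rewrite subr_eq0 eq_sym; apply: contraTneq x1 => ->; rewrite normr1 ltxx.
pose a n := if (k <= n)%N then p else 0.
have a01 n : 0 <= a n <= 1 by rewrite /a; case: ifP => // _; rewrite lexx ler01.
rewrite (sum_from_split k a01 x1) big_nat big1 ?add0r; last first.
  by move=> j /andP[_ jk]; rewrite /a leqNgt jk mul0r.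
apply: sum_fromE.
have xn : (fun n => x ^+ n : R[i]^o) @ \oo --> (0 : R[i]^o).
  have /cvg_complex/cvgrPdist_le X0 : geometric 1 (complex.Re `|x|) @ \oo --> (0 : R).
    by apply: cvg_geometric; rewrite ger0_norm ?Re_norm_ge0 ?Re_norm_lt1.
  apply/cvgrPdist_le => e /X0; apply: filterS => n.
  rewrite /= mul1r !sub0r !normrN rmorphXn /= -norm_complexE.
  by rewrite normrX normr_id -normrX.
rewrite -[X in _ --> X]subr0 -[X in _ - X](mul0r (p%:C%C / (1 - x))).
apply: (cvg_trans _ (cvgB (cvg_cst (x ^+ k * p%:C%C / (1 - x) : R[i]^o))
   (cvgM xn (cvg_cst (p%:C%C / (1 - x) : R[i]^o))))).
apply: near_eq_cvg; near=> n.
have kn : (k <= n)%N by near: n; exact: nbhs_infty_ge.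
rewrite !fctE -mulrA -mulrBl -(subnKC kn); elim: (n - k)%N => [|m IH].
  by rewrite addn0 subrr mul0r big_geq.
rewrite addnS big_nat_recr ?leq_addr//= -IH /a leq_addr exprS.
by field.
Unshelve. all: by end_near. Qed.

Lemma sum_fromD a u v x :
  (forall n, 0 <= u n <= 1) -> (forall n, 0 <= v n <= 1) -> `|x| < 1 ->
  (forall n, a n = u n + v n) ->
  sum_from 0 (fun n => (a n)%:C%C * x ^+ n) =
  sum_from 0 (fun n => (u n)%:C%C * x ^+ n)
  + sum_from 0 (fun n => (v n)%:C%C * x ^+ n).
Proof.
move=> u01 v01 x1 aE; apply: sum_fromE.
rewrite (_ : (fun n => _) =
    (fun n => (psum u x n : R[i]^o) + (psum v x n : R[i]^o))).
  by apply: cvgD; exact: cvg_sum_from0.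
apply/funext => n; rewrite /psum -big_split; apply: eq_bigr => j _ /=.
by rewrite aE rmorphD /= mulrDl.
Qed.

Lemma sum_from_head (b : nat -> R[i]) :
  (forall n, (0 < n)%N -> b n = 0) -> sum_from 0 b = b 0%N.
Proof.
move=> b0; apply: sum_fromE.
apply: (cvg_trans _ (@cvg_cst _ (b 0%N : R[i]^o) nat \oo _)).
apply: near_eq_cvg; near=> n.
have n0 : (0 < n)%N by near: n; exact: nbhs_infty_gt.
rewrite big_ltn// big_nat big1 => [|j /andP[j0 _]]; [by rewrite addr0|exact: b0].
Unshelve. all: by end_near. Qed.

End power_series.

(** * Left-infinite sequences and the transition kernel *)

Section left_infinite_sequences.

(** The set is a countable union of cylinders.  All the measurability proofs
    below go back to this one. *)
Lemma measurable_prefix k (f : set (seq bool)) :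
  measurable ([set s | f (mkseq s k)] : set L).
Proof.
rewrite (_ : [set s | _] =
    \bigcup_(v : seq bool) [set s : L | [/\ size v = k, f v & cylinder (rev v) s]]).
  apply: countable_bigcupT_measurable => [|v]; first exact: countableP.
  have [[vk fv]|nv] := pselect (size v = k /\ f v).
    rewrite (_ : [set s : L | _] = cylinder (rev v)).
      by apply: sub_sigma_algebra; exists (rev v).
    by apply/seteqP; split=> s /= => [[]|].
  rewrite (_ : [set s : L | _] = set0); first exact: measurable0.
  by apply/seteqP; split=> s //= [vk fv _]; apply: nv.
apply/seteqP; split=> s /=.
  move=> fs; exists (mkseq s k) => //=; split; rewrite ?size_mkseq//.
  by rewrite /cylinder /= size_rev size_mkseq revK.
by case=> v _ [<- fv]; rewrite /cylinder /= size_rev revK => ->.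
Qed.

Lemma measurable_cylinder w : measurable (cylinder w : set L).
Proof. exact: (measurable_prefix (size w) [set v | v = rev w]). Qed.

Lemma measurable_coord i b : measurable ([set s | s i = b] : set L).
Proof.
rewrite (_ : [set s : L | _] = [set s : L | nth b (mkseq s i.+1) i = b]).
  exact: (measurable_prefix i.+1 [set v | nth b v i = b]).
by apply/seteqP; split=> s /=; rewrite nth_mkseq.
Qed.

Lemma pref_SomeE n : [set s : L | pref s = Some n] = cylinder (rev (leaf n)).
Proof.
apply/seteqP; split=> s /=; rewrite /cylinder /= size_rev revK => sn.
  by have := prefP s; rewrite sn.
exact: (@pref_uniq s (Some n)).
Qed.

Lemma measurable_pref c : measurable ([set s | pref s = c] : set L).
Proof.
have mS n : measurable ([set s | pref s = Some n] : set L).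
  by rewrite pref_SomeE; exact: measurable_cylinder.
case: c => [n|]; first exact: mS.
rewrite (_ : [set s : L | _] = ~` \bigcup_n [set s : L | pref s = Some n]).
  by apply: measurableC; exact: bigcupT_measurable.
apply/seteqP; split=> s /=; first by move=> sN [n _] /=; rewrite sN.
by case E: (pref s) => [n|//] sn; exfalso; apply: sn; exists n.
Qed.

(** Reading 1 leads to the context 1, reading 0 after [0^n 1] leads to
    [0^(n+1) 1]: along finite contexts, the next context is a function of the
    current one and of the new letter. *)
Lemma pref_append (s : L) n a : pref s = Some n ->
  pref (append s a) = Some (if a then 0%N else n.+1).
Proof.
move=> sn; have := prefP s; rewrite sn [context_prefix _ _]leaf_mkseq => -[s1 s0].
apply: pref_uniq; case: a; rewrite [context_prefix _ _]leaf_mkseq; split=> //.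
by case.
Qed.

Lemma measurable_append a : measurable_fun setT (append ^~ a : L -> L).
Proof.
apply: (@measurability _ _ L L setT (append ^~ a) cylinders erefl) => _ [_ [w _ <-] <-].
rewrite setTI; case/lastP: w => [|w b].
  by rewrite (_ : _ @^-1` _ = setT)//; apply/seteqP; split.
rewrite (_ : _ @^-1` _ = [set s | a :: mkseq s (size w) = rev (rcons w b)]).
  exact: (measurable_prefix (size w) [set v | a :: v = rev (rcons w b)]).
apply/seteqP; split=> s /=; rewrite /cylinder /= size_rcons /mkseq /=;
  by rewrite (iotaDl 1 0) -map_comp.
Qed.

Variables (R : realType) (q : context -> probability bool R).
Implicit Types B : set L.
Local Open Scope ereal_scope.

Lemma vlmc_kernel_ge0 s B : 0 <= vlmc_kernel q s B.
Proof. by apply: sume_ge0 => a _; apply: mule_ge0. Qed.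

Lemma measurable_vlmc_kernel B : measurable B ->
  measurable_fun setT (vlmc_kernel q ^~ B).
Proof.
move=> mB; apply: emeasurable_sum => a; apply: emeasurable_funM; last first.
  apply: (@measurableT_comp _ _ _ _ _ _ (fun s : L => \d_s B)).
    exact: measurable_fun_dirac.
  exact: measurable_append.
move=> _ Y mY; rewrite setTI.
rewrite (_ : _ @^-1` _ = \bigcup_(c : context)
    [set s | pref s = c /\ Y (q c [set a])]).
  apply: countable_bigcupT_measurable => [|c]; first exact: countableP.
  have [Yc|nYc] := pselect (Y (q c [set a])).
    rewrite (_ : [set s | _] = [set s | pref s = c]); first exact: measurable_pref.
    by apply/seteqP; split=> s /= => [[]|].
  by rewrite (_ : [set s | _] = set0)//; apply/seteqP; split=> s //= [].
apply/seteqP; split=> s /= => [Ys|[c _ [<-]]//].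
by exists (pref s).
Qed.

Lemma sum_letter_prob c : q c [set false] + q c [set true] = 1.
Proof.
rewrite -measureU//.
  rewrite -(probability_setT (q c)); congr (q c _).
  by apply/seteqP; split=> -[] //= _; [right|left].
by apply/seteqP; split=> -[] //= [].
Qed.

Lemma vlmc_kernel_last s a :
  vlmc_kernel q s [set t : L | t 0%N = a] = q (pref s) [set a].
Proof.
rewrite /vlmc_kernel big_bool /= !diracE.
have E b : (append s b \in [set t : L | t 0%N = a]) = (b == a).
  by apply/idP/eqP => [/set_mem//|ba]; apply: mem_set.
by rewrite !E; case: a {E}; rewrite /= ?mule1 ?mule0 ?adde0 ?add0e.
Qed.

(** A transition only appends a letter: it keeps the past deterministically. *)
Lemma vlmc_kernel_past s i b :
  vlmc_kernel q s [set t : L | t i.+1 = b] = (s i == b)%:R%:E.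
Proof.
rewrite /vlmc_kernel big_bool /= !diracE.
have E a : (append s a \in [set t : L | t i.+1 = b]) = (s i == b).
  by apply/idP/eqP => [/set_mem//|si]; apply: mem_set.
by rewrite !E -ge0_muleDl ?sum_letter_prob ?mul1e// addeC sum_letter_prob mul1e.
Qed.

End left_infinite_sequences.

(** * Filtration, coherent trajectories and the Markov property *)

Section vlmc_process.
Context (R : realType) (d : measure_display) (Omega : measurableType d).
Variables (P : probability Omega R) (q : context -> probability bool R).
Variable U : nat -> {RV P >-> L}.
Implicit Types (E A B : set Omega) (w u : seq bool).

Notation F := (natural_filtration U).
Notation pr A := (fine (P A)).

Lemma filtrationC n E : F n E -> F n (~` E).
Proof. by move=> FE; rewrite -setTD; exact: sigma_algebraCD. Qed.

Lemma filtration_bigcup n (E : (set Omega)^nat) :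
  (forall i, F n (E i)) -> F n (\bigcup_i E i).
Proof. exact: sigma_algebra_bigcup. Qed.

Lemma filtration0 n : F n set0.
Proof. exact: sigma_algebra0. Qed.

Lemma filtrationT n : F n setT.
Proof. by rewrite -setC0; apply: filtrationC; exact: filtration0. Qed.

Lemma filtrationU n A B : F n A -> F n B -> F n (A `|` B).
Proof.
move=> FA FB; rewrite -bigcup2E; apply: filtration_bigcup => -[|[|i]] //=.
exact: filtration0.
Qed.

Lemma filtrationI n A B : F n A -> F n B -> F n (A `&` B).
Proof.
move=> FA FB; rewrite -[A `&` B]setCK setCI.
by apply: filtrationC; apply: filtrationU; exact: filtrationC.
Qed.

Lemma filtration_preimage m n (B : set L) : (m <= n)%N -> measurable B ->
  F n (U m @^-1` B).
Proof.
move=> mn mB; apply: sub_sigma_algebra; exists m => //=; exists B => //.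
by rewrite setTI.
Qed.

Lemma filtration_mono m n E : (m <= n)%N -> F m E -> F n E.
Proof.
move=> mn; apply: sub_sigma_algebra2 => A [i /= im Ai]; exists i => //=.
exact: leq_trans im _.
Qed.

Lemma filtration_measurable n E : F n E -> measurable E.
Proof.
apply: smallest_sub; first exact: sigma_algebra_measurable.
move=> A [i _ [B mB <-]]; exact: measurable_funP.
Qed.

Lemma filtration_letter n (z : int) b : z <= n%:Z ->
  F n [set o | letter U z o = b].
Proof.
case: z => [m|m] zn; apply: (@filtration_preimage _ n [set s | s _ = b]) => //;
  exact: measurable_coord.
Qed.

(** By induction on [k], splitting according to the last letter, so as to stay
    within finite unions and intersections. *)
Lemma filtration_mkseq n (f : nat -> Omega -> bool) k (g : seq bool -> Prop) :
  (forall i b, (i < k)%N -> F n [set o | f i o = b]) ->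
  F n [set o | g (mkseq (f^~ o) k)].
Proof.
elim: k g => [|k IH] g Ff.
  have [g0|g0] := pselect (g [::]).
    by rewrite (_ : [set o | _] = setT); [exact: filtrationT|apply/seteqP; split].
  by rewrite (_ : [set o | _] = set0); [exact: filtration0|apply/seteqP; split].
pose G b := [set o | g (rcons (mkseq (f^~ o) k) b)] `&` [set o | f k o = b].
rewrite (_ : [set o | _] = G true `|` G false).
  have FG b : F n (G b).
    apply: filtrationI; last exact: Ff.
    by apply: (IH (fun v => g (rcons v b))) => i c ik; apply: Ff; exact: ltnW.
  exact: filtrationU.
apply/seteqP; split=> o; rewrite /G /= mkseqS.
  by case: (f k o); [left|right].
by case=> -[+ ->].
Qed.

Lemma filtration_reads n u (z : int) : z <= n%:Z -> F n [set o | reads U u z o].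
Proof.
move=> zn; apply: (@filtration_mkseq n
  (fun i => letter U (z - (size u)%:Z + 1 + i%:Z)) _ (fun v => v = u)) => i b ik.
by apply: filtration_letter; lia.
Qed.

Lemma filtration_occurs n m w : (m <= n)%N -> F n [set o | occurs U w m o].
Proof.
move=> mn; have [km|km] := boolP (size w <= m)%N.
  rewrite (_ : [set o | _] = [set o | reads U w m%:Z o]).
    exact: filtration_reads.
  by apply/seteqP; split=> o; rewrite /occurs /=; [case|split].
rewrite (_ : [set o | _] = set0); first exact: filtration0.
by apply/seteqP; split=> o //= []; rewrite (negbTE km).
Qed.

Lemma nb_occS w n o :
  nb_occ U w n.+1 o = (nb_occ U w n o + `[< occurs U w n.+1 o >])%N.
Proof. by rewrite /nb_occ big_ord_recr. Qed.

Lemma nb_occ0 w o : nb_occ U w 0 o = `[< occurs U w 0 o >] :> nat.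
Proof. by rewrite /nb_occ big_ord1. Qed.

Lemma filtration_nb_occ n m w r : (m <= n)%N -> F n [set o | nb_occ U w m o = r].
Proof.
elim: m r => [|m IH] r mn.
  have FO := @filtration_occurs n 0 w mn.
  case: r => [|[|r]].
  - rewrite (_ : [set o | _] = ~` [set o | occurs U w 0 o]); first exact: filtrationC.
    by apply/seteqP; split=> o /=; rewrite nb_occ0; case: asboolP.
  - rewrite (_ : [set o | _] = [set o | occurs U w 0 o])//.
    by apply/seteqP; split=> o /=; rewrite nb_occ0; case: asboolP.
  - rewrite (_ : [set o | _] = set0); first exact: filtration0.
    by apply/seteqP; split=> o //=; rewrite nb_occ0; case: asboolP.
have FO := @filtration_occurs n m.+1 w mn.
have F0 : F n ([set o | nb_occ U w m o = r] `&` ~` [set o | occurs U w m.+1 o]).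
  by apply: filtrationI; [by apply: IH; exact: ltnW|exact: filtrationC].
case: r F0 => [|r] F0.
  rewrite [X in F n X](_ : _ =
    [set o | nb_occ U w m o = 0%N] `&` ~` [set o | occurs U w m.+1 o])//.
  apply/seteqP; split=> o /=; rewrite nb_occS; case: asboolP => /= ow.
  - by rewrite addn1.
  - by rewrite addn0.
  - by case.
  - by rewrite addn0 => -[].
rewrite [X in F n X](_ : _ =
  [set o | nb_occ U w m o = r.+1] `&` ~` [set o | occurs U w m.+1 o] `|`
  [set o | nb_occ U w m o = r] `&` [set o | occurs U w m.+1 o]).
  by apply: filtrationU => //; apply: filtrationI => //; apply: IH; exact: ltnW.
apply/seteqP; split=> o /=; rewrite nb_occS; case: asboolP => /= ow.
- by rewrite addn1 => -[<-]; right.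
- by rewrite addn0; left.
- by rewrite addn1 => -[[]//|[<-]].
- by rewrite addn0 => -[[]|[]].
Qed.

Hypothesis U_vlmc : is_vlmc q U.

(** The event that each [U n.+1] extends [U n] by one letter. *)
Definition coherent : set Omega :=
  [set o | forall n i, U n.+1 o i.+1 = U n o i].

(** Given [U n o i = b], the kernel charges { t | t i.+1 = ~~ b } with mass 0;
    countably many such events cover the complement of [coherent]. *)
Lemma incoherent_negligible : P.-negligible (~` coherent).
Proof.
suff H n i : P.-negligible [set o | U n.+1 o i.+1 <> U n o i].
  apply: (@negligibleS _ _ _ _ (\bigcup_n \bigcup_i [set o | U n.+1 o i.+1 <> U n o i])).
    move=> o /= No; apply: contrapT => B; apply: No => n i.
    by apply: contrapT => ni; apply: B; exists n => //; exists i.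
  by apply: negligible_bigcup => n; apply: negligible_bigcup => i.
pose A b := [set o | U n o i = b].
(* the letter [b] at index [i] of [U n] is changed by the transition *)
pose D b := A b `&` U n.+1 @^-1` [set t : L | t i.+1 = ~~ b].
have FA b : F n (A b).
  by apply: (@filtration_preimage n n [set s | s i = b]) => //; exact: measurable_coord.
have D0 b : P.-negligible (D b).
  exists (D b); split => //.
    apply: measurableI; first exact: filtration_measurable (FA b).
    by apply: measurable_funPTI; exact: measurable_coord.
  rewrite /D U_vlmc//; last exact: measurable_coord.
  rewrite integral0_eq// => o Ao; rewrite vlmc_kernel_past Ao.
  by case: (b).
apply: (negligibleS _ (negligibleU (D0 true) (D0 false))) => o; rewrite /D /A /=.
by case: (U n o i) (U n.+1 o i.+1) => -[] //= _; [left|right].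
Qed.

(** All almost sure identities are used through this lemma. *)
Lemma P_eq_coherent A B : measurable A -> measurable B ->
  (forall o, coherent o -> A o <-> B o) -> P A = P B.
Proof.
have [N [mN N0 cN]] := incoherent_negligible.
suff le A' B' : measurable A' -> measurable B' ->
    (forall o, coherent o -> A' o <-> B' o) -> (P A' <= P B')%E.
  move=> mA mB AB; apply/eqP; rewrite eq_le !le// => o /AB[]; by split.
move=> mA mB AB; rewrite -(measureU0 mB mN N0) le_measure ?inE//.
  exact: measurableU.
move=> o Ao; have [co|/cN] := pselect (coherent o); last by right.
by left; apply/(AB o co).
Qed.

(** The letters were defined from [U 0] and from the heads of the [U n]; on
    coherent trajectories any [U n] carries the whole past. *)
Lemma coherent_letter o (n i : nat) : coherent o ->
  letter U (n%:Z - i%:Z) o = U n o i.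
Proof.
move=> co; elim: n i => [|n IH] [|i]; rewrite ?subr0// ?sub0r//.
by rewrite co -IH; congr letter; lia.
Qed.

Lemma reads_cylinder u n o : coherent o ->
  reads U u n%:Z o <-> cylinder u (U n o).
Proof.
move=> co; rewrite /reads /cylinder /=.
have -> : mkseq (fun i => letter U (n%:Z - (size u)%:Z + 1 + i%:Z) o) (size u)
    = rev (mkseq (U n o) (size u)).
  apply: (@eq_from_nth _ false); rewrite ?size_rev !size_mkseq// => i ik.
  rewrite nth_rev size_mkseq// !nth_mkseq//; last by lia.
  by rewrite -coherent_letter//; congr letter; lia.
by split=> [/(congr1 rev)|->]; rewrite revK.
Qed.

Lemma coherent_pref u n o c : coherent o -> suffix (rev (leaf c)) u ->
  reads U u n%:Z o -> pref (U n o) = Some c.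
Proof.
move=> co /suffixP[v uE] /(reads_cylinder _ _ co); rewrite /cylinder /= => E.
apply: pref_uniq => /=.
have := congr1 (take (size (leaf c))) E.
rewrite uE rev_cat revK take_size_cat// size_cat size_rev.
by rewrite /mkseq -map_take take_iota (minn_idPl _)// leq_addl.
Qed.

(** The probability, starting from the context [leaf c], that the next [j]
    letters satisfy [f]. *)
Fixpoint future_prob (c j : nat) (f : seq bool -> bool) : R :=
  if j is i.+1 then
    \sum_(a : bool) fine (q (Some c) [set a])
      * future_prob (if a then 0%N else c.+1) i (fun v => f (a :: v))
  else (f [::])%:R.

Definition future (m j : nat) (o : Omega) : seq bool :=
  mkseq (fun i => U (m + i.+1)%N o 0%N) j.

Lemma futureS m j o : future m j.+1 o = U m.+1 o 0%N :: future m.+1 j o.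
Proof.
rewrite /future /mkseq /= (iotaDl 1 0) -map_comp /= addn1; congr cons.
by apply: eq_map => i /=; rewrite add1n addSnnS.
Qed.

Lemma measurable_future m j (f : seq bool -> bool) :
  measurable [set o | f (future m j o)].
Proof.
apply: (@filtration_measurable (m + j)).
apply: (@filtration_mkseq _ (fun i o => U (m + i.+1)%N o 0%N) _ f) => i b ij.
apply: (@filtration_preimage (m + i.+1) (m + j) [set s | s 0%N = b]).
  by rewrite leq_add2l.
exact: measurable_coord.
Qed.

Lemma P_fin A : measurable A -> P A \is a fin_num.
Proof. exact: fin_num_measure. Qed.

Lemma pr_disjointU A B : measurable A -> measurable B -> (forall o, A o -> ~ B o) ->
  pr (A `|` B) = pr A + pr B.
Proof.
move=> mA mB AB; rewrite measureU ?fineD ?P_fin//.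
by apply/seteqP; split=> o //= [/AB].
Qed.

(** The Markov property along finite contexts: conditionally on any event known
    at time [m] that forces the context [leaf c], the law of the next letters
    depends on [c] only. *)
Lemma markov_future j (f : seq bool -> bool) m E c : F m E ->
  (forall o, E o -> pref (U m o) = Some c) ->
  pr (E `&` [set o | f (future m j o)]) = pr E * future_prob c j f.
Proof.
elim: j f m E c => [|j IH] f m E c FE Ec /=.
  rewrite [X in _ `&` X](_ : _ = [set o | f [::]])//.
  case: (f [::]).
    by rewrite mulr1 (_ : [set o | _] = setT) ?setIT//; apply/seteqP; split.
  rewrite mulr0 (_ : [set o | _] = set0) ?setI0 ?measure0//.
  by apply/seteqP; split.
pose next a := if a then 0%N else c.+1.
pose step a := U m.+1 @^-1` [set t : L | t 0%N = a].
(* [step a] moves to the context [next a] on coherent trajectories only, hence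
   the induction hypothesis applies to [G a] rather than to [E `&` step a] *)
pose G a := E `&` step a `&` U m.+1 @^-1` [set t : L | pref t = Some (next a)].
have mstep a : measurable (step a) by apply: measurable_funPTI; exact: measurable_coord.
have FEs a : F m.+1 (E `&` step a).
  apply: filtrationI; first exact: (filtration_mono (leqnSn m)).
  by apply: filtration_preimage => //; exact: measurable_coord.
have FG a : F m.+1 (G a).
  by apply: filtrationI => //; apply: filtration_preimage => //; exact: measurable_pref.
have mE := filtration_measurable FE.
have stepE a : pr (E `&` step a) = pr E * fine (q (Some c) [set a]).
  rewrite U_vlmc//; last exact: measurable_coord.
  under eq_integral => o /set_mem/Ec oc do rewrite vlmc_kernel_last oc.
  by rewrite integral_cst// fineM ?P_fin// 1?mulrC// fin_num_measure.
have branch a : pr (E `&` step a `&` [set o | f (a :: future m.+1 j o)]) =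
    pr E * (fine (q (Some c) [set a]) * future_prob (next a) j (fun v => f (a :: v))).
  have mf := measurable_future m.+1 j (fun v => f (a :: v)).
  have GE o : coherent o -> G a o <-> (E `&` step a) o.
    move=> co; split=> [[]//|[Eo so]]; split=> //=.
    rewrite (_ : U m.+1 o = append (U m o) a) ?(pref_append _ (Ec _ Eo))//.
    by apply/funext => -[|i]; [exact: so|exact: co].
  have mEs := filtration_measurable (FEs a).
  have mG := filtration_measurable (FG a).
  rewrite mulrA -stepE -(P_eq_coherent mG mEs GE).
  rewrite -(IH (fun v => f (a :: v)) _ _ _ (FG a)); last by move=> o [].
  congr fine; apply: P_eq_coherent; [exact: measurableI|exact: measurableI|].
  by move=> o /GE[G1 G2]; split=> -[] /= => [/G2|/G1].
rewrite big_bool mulrDr -!branch -pr_disjointU.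
- congr (pr _); apply/seteqP; split=> o; rewrite /step /= futureS.
    by case: (U m.+1 o 0%N) => -[]; [left|right].
  by case=> -[[Eo ->]].
- by apply: measurableI; [exact: filtration_measurable (FEs _)|exact: (measurable_future _ _ (fun v => f (true :: v)))].
- by apply: measurableI; [exact: filtration_measurable (FEs _)|exact: (measurable_future _ _ (fun v => f (false :: v)))].
- by move=> o [[_ +] _] [[_ +] _]; rewrite /step /= => ->.
Qed.

Lemma reads_future u m j o : (size u <= j)%N ->
  reads U u (m + j)%N%:Z o <-> drop (j - size u) (future m j o) == u.
Proof.
move=> uj; rewrite /reads.
have -> : mkseq (fun i => letter U ((m + j)%N%:Z - (size u)%:Z + 1 + i%:Z) o) (size u)
    = drop (j - size u) (future m j o).
  apply: (@eq_from_nth _ false).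
    by rewrite size_drop !size_mkseq subKn.
  move=> i; rewrite size_mkseq => ik.
  rewrite nth_drop !nth_mkseq//; last by lia.
  rewrite (_ : _ - _ + 1 + _ = (m + (j - size u + i).+1)%N%:Z)//; lia.
by split=> [->|/eqP].
Qed.

End vlmc_process.

(** * Stationarity and the probabilities of reading a word from a context *)

Lemma suffix_comparable (T : eqType) (w u v : seq T) :
  suffix u w -> suffix v w -> (size u <= size v)%N -> suffix u v.
Proof.
rewrite !suffixE => /eqP uE /eqP vE uv.
have vw : (size v <= size w)%N by rewrite -vE size_drop leq_subr.
have vd n : drop n v = drop (n + (size w - size v)) w by rewrite -drop_drop vE.
by rewrite vd; apply/eqP; rewrite -[RHS]uE; congr drop; lia.
Qed.

Section stationary_vlmc.
Context (R : realType) (d : measure_display) (Omega : measurableType d).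
Variables (P : probability Omega R) (q : context -> probability bool R).
Variables (U : nat -> {RV P >-> L}) (pi : probability L R).
Hypothesis statU : stationary_vlmc q U pi.
Implicit Types (E A B : set Omega) (u v : seq bool).

Notation F := (natural_filtration U).
Notation pr A := (fine (P A)).

Let U_vlmc : is_vlmc q U. Proof. by case: statU. Qed.

(** By induction on [n], pushing the kernel forward along [U n]. *)
Lemma law_stationary n (B : set L) : measurable B -> P (U n @^-1` B) = pi B.
Proof.
have [_ stat law0] := statU.
elim: n B => [|n IH] B mB; first exact: law0.
rewrite -[_ @^-1` _]setTI U_vlmc//; last exact: filtrationT.
rewrite [RHS]stat//.
rewrite -[LHS](@ge0_integral_pushforward _ _ _ _ _ (U n) _ P setT
  (fun s => vlmc_kernel q s B))//.
- by apply: eq_measure_integral => A mA _; exact: IH.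
- exact: measurable_vlmc_kernel.
- by move=> s _; exact: vlmc_kernel_ge0.
Qed.

Lemma measurable_reads u (z : int) : measurable [set o | reads U u z o].
Proof.
case: z => n; first by apply: (@filtration_measurable _ _ _ _ U n); exact: filtration_reads.
by apply: (@filtration_measurable _ _ _ _ U 0); exact: filtration_reads.
Qed.

Lemma P_reads_stationary u n : P [set o | reads U u n%:Z o] = pi (cylinder u).
Proof.
rewrite -(law_stationary n)//; last exact: measurable_cylinder.
apply: (P_eq_coherent U_vlmc); first exact: measurable_reads.
  by apply: measurable_funPTI; exact: measurable_cylinder.
by move=> o co; exact: reads_cylinder.
Qed.

Lemma le_pr A B : measurable A -> measurable B -> A `<=` B -> pr A <= pr B.
Proof. by move=> mA mB AB; rewrite fine_le ?P_fin// le_measure ?inE. Qed.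

Lemma pr01 A : measurable A -> 0 <= pr A <= 1.
Proof.
move=> mA; rewrite fine_ge0 ?measure_ge0//=.
by rewrite -lee_fin fineK ?P_fin// probability_le1.
Qed.

Lemma reads_cat u v (z : int) o :
  reads U (u ++ v) z o <-> reads U u (z - (size v)%:Z) o /\ reads U v z o.
Proof.
rewrite /reads size_cat /mkseq iotaD map_cat add0n.
have -> : [seq letter U (z - (size u + size v)%N%:Z + 1 + i%:Z) o | i <- iota 0 (size u)]
  = [seq letter U (z - (size v)%:Z - (size u)%:Z + 1 + i%:Z) o | i <- iota 0 (size u)].
  by apply: eq_map => i; congr letter; lia.
have -> : [seq letter U (z - (size u + size v)%N%:Z + 1 + i%:Z) o
            | i <- iota (size u) (size v)]
  = [seq letter U (z - (size v)%:Z + 1 + i%:Z) o | i <- iota 0 (size v)].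
  rewrite -[X in iota X _]addn0 iotaDl -map_comp.
  by apply: eq_map => i /=; congr letter; lia.
split=> [/eqP|[-> ->]//]; rewrite eqseq_cat ?size_map ?size_iota//.
by case/andP => /eqP-> /eqP->.
Qed.

Lemma reads_inj u v (z : int) o : size u = size v ->
  reads U u z o -> reads U v z o -> u = v.
Proof. by rewrite /reads => -> -> ->. Qed.

Section visited_context.
Variable c : nat.
Hypothesis visited : P [set o | reads U (rev (leaf c)) 0 o] != 0%E.

Let leaf_event := [set o | reads U (rev (leaf c)) 0 o].

Lemma visited_gt0 : 0 < pr leaf_event.
Proof.
have mG : measurable leaf_event by exact: measurable_reads.
rewrite lt0r fine_eq0 ?P_fin// visited.
by case/andP: (pr01 mG).
Qed.

Lemma markov_reads_aux m E j u : F m E ->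
  (forall o, coherent U o -> E o -> pref (U m o) = Some c) ->
  (size u <= j)%N ->
  pr (E `&` [set o | reads U u (m + j)%N%:Z o]) =
  pr E * future_prob q c j (fun v => drop (j - size u) v == u).
Proof.
move=> FE Ec uj; pose G := E `&` U m @^-1` [set s : L | pref s = Some c].
have FG : F m G.
  by apply: filtrationI => //; apply: filtration_preimage => //; exact: measurable_pref.
have mE := filtration_measurable FE; have mG := filtration_measurable FG.
have GE o : coherent U o -> G o <-> E o.
  by move=> co; split=> [[]//|Eo]; split=> //; exact: Ec.
rewrite -(P_eq_coherent U_vlmc mG mE GE).
rewrite -(markov_future U_vlmc j (fun v => drop _ v == u) FG); last by move=> o [].
congr fine; apply: (P_eq_coherent U_vlmc).
- by apply: measurableI => //; exact: measurable_reads.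
- by apply: measurableI => //; exact: (measurable_future U m j (fun v => drop _ v == u)).
- by move=> o /GE[G1 G2]; rewrite /= -reads_future//; split=> -[/= o1 o2]; split=> //;
    [exact: G2|exact: G1].
Qed.

(** The conditioning event of [qn] forces the context [leaf c] at time 0, so
    that [qn] is an instance of [future_prob]. *)
Lemma qnE j u : (size u <= j)%N ->
  qn U c j u = future_prob q c j (fun v => drop (j - size u) v == u).
Proof.
move=> uj; rewrite /qn.
rewrite (_ : [set o | _ /\ _] = leaf_event `&` [set o | reads U u (0 + j)%N%:Z o]).
  rewrite markov_reads_aux//.
  - by rewrite mulrAC mulfV ?mul1r// lt0r_neq0// visited_gt0.
  - exact: filtration_reads.
  - by move=> o co; apply: coherent_pref => //; exact: suffix_refl.
by rewrite add0n; apply/seteqP; split=> o /= [].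
Qed.

(** The bound on [size u] says that [u] is read entirely after time [m]. *)
Lemma markov_reads m E j u : F m E ->
  (forall o, coherent U o -> E o -> pref (U m o) = Some c) ->
  (size u <= j)%N ->
  pr (E `&` [set o | reads U u (m + j)%N%:Z o]) = pr E * qn U c j u.
Proof. by move=> FE Ec uj; rewrite markov_reads_aux// qnE. Qed.

Lemma qn01 j u : 0 <= qn U c j u <= 1.
Proof.
have m1 : measurable [set o | reads U u j%:Z o /\ reads U (rev (leaf c)) 0 o].
  by apply: (@measurableI _ _ [set o | reads U u j%:Z o]); exact: measurable_reads.
have m2 : measurable leaf_event by exact: measurable_reads.
have [p0 _] := andP (pr01 m1).
rewrite /qn divr_ge0//= ?ler_pdivrMr ?visited_gt0// ?(ltW visited_gt0)// mul1r.
by apply: le_pr => // o [].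
Qed.

Lemma qn_eq0 j u : pi (cylinder u) = 0%E -> qn U c j u = 0.
Proof.
move=> u0; rewrite /qn (_ : pr _ = 0) ?mul0r//; apply/eqP.
have m1 : measurable [set o | reads U u j%:Z o /\ reads U (rev (leaf c)) 0 o].
  by apply: (@measurableI _ _ [set o | reads U u j%:Z o]); exact: measurable_reads.
rewrite eq_le; have [-> _] := andP (pr01 m1); rewrite andbT.
rewrite -[leRHS]/(fine 0%E) -u0 -(P_reads_stationary u j); apply: le_pr => //.
  exact: measurable_reads.
by move=> o [].
Qed.

Local Notation pw u := (pr [set o | reads U u 0%N%:Z o]).

Lemma pw_suffix u v : suffix u v -> pw v <= pw u.
Proof.
move=> /suffixP[v' ->]; apply: le_pr; try exact: measurable_reads.
by move=> o /= /reads_cat[].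
Qed.

Lemma pw_cat_gt0 v u : suffix (rev (leaf c)) v -> 0 < pw v ->
  0 < qn U c (size u) u -> 0 < pw (v ++ u).
Proof.
move=> cv v0 u0; rewrite P_reads_stationary -(P_reads_stationary _ (size u)).
rewrite (_ : [set o | _] = [set o | reads U v 0%N%:Z o] `&`
   [set o | reads U u (0 + size u)%N%:Z o]).
  have FV : F 0 [set o | reads U v 0%N%:Z o] by exact: filtration_reads.
  rewrite (markov_reads FV)//; first exact: mulr_gt0.
  by move=> o co /=; exact: coherent_pref.
by apply/seteqP; split=> o /=; rewrite reads_cat subrr.
Qed.

(** A shift [j] for which [w] overlaps itself is a period of [w]; with [u] the
    last [j] letters, each suffix of [w] longer than [j] is a shorter suffix
    followed by [u].  Growing the suffixes of [w] this way, each of them has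
    positive probability: either the shorter suffix already ends with
    [rev (leaf c)], and [u] can be read after it, or it is itself a suffix of
    [rev (leaf c)], which is visited. *)
Lemma overlap_gt0 w j : suffix (rev (leaf c)) w -> (0 < j < size w)%N ->
  drop j w = take (size w - j) w ->
  0 < qn U c j (drop (size w - j) w) -> 0 < pw w.
Proof.
move=> cw /andP[j0 jw] wj; set u := drop (size w - j) w => u0.
have su : size u = j by rewrite size_drop subKn// ltnW.
have cu : 0 < pw (rev (leaf c) ++ u).
  by apply: pw_cat_gt0; rewrite ?suffix_refl ?su//; exact: visited_gt0.
suff H l : (l <= size w)%N -> 0 < pw (drop (size w - l) w).
  by have := H _ (leqnn _); rewrite subnn drop0.
elim/ltn_ind: l => l IH lw.
have [lj|jl] := leqP l j.
  apply: (lt_le_trans cu); apply: pw_suffix; apply: suffix_catr.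
  by apply: (suffix_comparable (w := w)); rewrite ?suffix_drop// size_drop subKn ?su.
set v := drop (size w - (l - j)) w.
have -> : drop (size w - l) w = v ++ u.
  rewrite -[X in drop _ X = _](cat_take_drop (size w - j) w) drop_cat size_takel ?leq_subr//.
  rewrite ifT; last by lia.
  by rewrite -wj drop_drop; congr (drop _ _ ++ _); lia.
have v0 : 0 < pw v by apply: IH; lia.
have sv : size v = (l - j)%N by rewrite size_drop subKn//; lia.
have [cv|vc] := leqP (size (rev (leaf c))) (size v).
  apply: pw_cat_gt0; rewrite ?su//.
  by apply: (suffix_comparable (w := w)); rewrite // suffix_drop.
apply: (lt_le_trans cu); apply: pw_suffix; rewrite suffix_catl// eqxx.
by apply: (suffix_comparable (w := w)); rewrite ?suffix_drop// ltnW.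
Qed.

End visited_context.
End stationary_vlmc.

(** * Occurrences as renewals and their generating functions *)

Section occurrences.
Context (R : realType) (d : measure_display) (Omega : measurableType d).
Variables (P : probability Omega R) (q : context -> probability bool R).
Variables (U : nat -> {RV P >-> L}) (pi : probability L R) (w : seq bool).

Notation F := (natural_filtration U).
Notation pr A := (fine (P A)).
Notation occ := (occurs U w).
Notation N := (nb_occ U w).
Let k := size w.
Let c := prefw w.

Lemma nb_occ_mono o : {homo N ^~ o : m n / (m <= n)%N}.
Proof.
apply: homo_leq => [//|m n p|n]; first exact: leq_trans.
by rewrite nb_occS leq_addr.
Qed.

Lemma nb_occ_lt o m n : occ n o -> (m < n)%N -> (N m o < N n o)%N.
Proof.
case: n => // n on mn; rewrite nb_occS asboolT// addn1 ltnS.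
exact: nb_occ_mono.
Qed.

Lemma nb_occ_inj o m n : occ m o -> occ n o -> N m o = N n o -> m = n.
Proof.
move=> om on mn; case: (ltngtP m n) => // [/(nb_occ_lt on)|/(nb_occ_lt om)];
  by rewrite mn ltnn.
Qed.

Lemma nb_occ_reach o n r : (0 < r <= N n o)%N ->
  exists m, [/\ (m <= n)%N, occ m o & N m o = r].
Proof.
elim: n => [|n IH] /andP[r0].
  rewrite nb_occ0; case: asboolP => o0; last by rewrite leqNgt r0.
  by move=> r1; exists 0%N; split; rewrite // nb_occ0 asboolT//; lia.
rewrite leq_eqVlt => /orP[/eqP rN|].
  have [on|on] := pselect (occ n.+1 o); first by exists n.+1.
  have [|m [mn om mr]] := IH; last by exists m; split; rewrite // ltnW.
  by rewrite r0 rN nb_occS asboolF//= addn0.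
rewrite nb_occS => rN; have [|m [mn om mr]] := IH; last by exists m; split; rewrite // ltnW.
by rewrite r0; move: rN; case: asboolP => _; rewrite ?addn1 ?addn0 ?ltnS// => /ltnW.
Qed.

(** Occurrences are numbered without repetition, so that the set whose element
    [position] chooses has at most one element. *)
Lemma positionE r o n : position U w r o = Some n <-> occ n o /\ N n o = r.
Proof.
rewrite /position; case: xgetP => [y _ [m [om mr] <-]|H].
  split=> [[<-]//|[on nr]]; congr Some.
  by apply: (nb_occ_inj om on); rewrite mr nr.
by split=> // -[on nr]; exfalso; apply: (H (Some n)); exists n.
Qed.

(** [P (T_w^(r) = n)]. *)
Definition position_prob r n : R := pr [set o | occ n o /\ N n o = r].

(** The probability that [w] occurs at [n] and that [T_w^(r) <= n]. *)
Definition late_occ_prob r n : R := pr [set o | occ n o /\ (r <= N n o)%N].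

(** The coefficients of [Sw], with a constant term 1 for the trivial return at
    [j = 0]. *)
Definition return_prob j : R :=
  if j == 0%N then 1
  else if (j < k)%N then (drop j w == take (k - j) w)%:R * qn U c j (drop (k - j) w)
  else qn U c j w.

Hypotheses (statU : stationary_vlmc q U pi) (k0 : (1 <= k)%N).
Hypothesis wN : ~ internal_node (rev w).
Hypothesis visited : P [set o | reads U (rev (leaf c)) 0 o] != 0%E.

Let U_vlmc : is_vlmc q U. Proof. by case: statU. Qed.

Lemma filtration_position r n : F n [set o | occ n o /\ N n o = r].
Proof.
by apply: (@filtrationI _ _ _ _ _ _ [set o | occ n o]);
  [exact: filtration_occurs|exact: filtration_nb_occ].
Qed.

Lemma measurable_position r n : measurable [set o | occ n o /\ N n o = r].
Proof. by apply: (@filtration_measurable _ _ _ _ U n); exact: filtration_position. Qed.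

Lemma measurable_late r n : measurable [set o | occ n o /\ (r <= N n o)%N].
Proof.
rewrite (_ : [set o | _] = [set o | occ n o] `&` [set o | (r <= N n o)%N])//.
apply: measurableI.
  exact: filtration_measurable (@filtration_occurs _ _ _ _ U n n w (leqnn n)).
rewrite (_ : [set o | _] = \bigcup_i [set o | N n o = (r + i)%N]).
  apply: bigcupT_measurable => i.
  exact: filtration_measurable (@filtration_nb_occ _ _ _ _ U n n w _ (leqnn n)).
apply/seteqP; split=> o /=; last by case=> i _ ->; rewrite leq_addr.
by move=> rN; exists (N n o - r)%N => //=; rewrite subnKC.
Qed.

(** For [j < k], [w] read at [m + j] splits into its first [k - j] letters, read
    at [m], and its last [j] letters, read after [m].  Since [w] is also read at
    [m], the first part amounts to the overlap condition. *)
Lemma return_probE m E j : F m E -> (forall o, E o -> occ m o) ->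
  pr (E `&` [set o | occ (m + j)%N o]) = pr E * return_prob j.
Proof.
move=> FE Eo; rewrite /return_prob.
have Ec o : coherent U o -> E o -> pref (U m o) = Some c.
  by move=> co /Eo[_]; apply: coherent_pref => //; exact: prefwP.
have [->|j0] := eqVneq j 0%N.
  rewrite mulr1 addn0; congr fine; congr (P _).
  by apply/seteqP; split=> o /= => [[]//|oE]; split=> //; exact: Eo.
have [jk|kj] := ltnP j k; last first.
  rewrite -(markov_reads statU visited FE)//; congr (pr _).
  apply/seteqP; split=> o /= [oE]; first by case.
  by split=> //; split=> //; exact: leq_trans kj (leq_addl _ _).
set u := drop (k - j) w; set v := take (k - j) w.
have su : size u = j by rewrite size_drop subKn// ltnW.
have again o : occ m o -> occ (m + j)%N o <->
    drop j w = v /\ reads U u (m + j)%N%:Z o.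
  move=> [km wm]; have wd : reads U (drop j w) m%:Z o.
    by move: wm; rewrite -{1}(cat_take_drop j w) => /reads_cat[].
  rewrite /occurs -{2}(cat_take_drop (k - j) w) reads_cat su.
  rewrite (_ : (m + j)%N%:Z - j%:Z = m%:Z); last by lia.
  split=> [[_ [vm uj]]|[wv uj]].
    split=> //; apply: (reads_inj _ wd vm).
    by rewrite size_drop size_takel ?leq_subr.
  by split; [exact: leq_trans km (leq_addr _ _)|split=> //; rewrite -/v -wv].
have [wv|wv] := eqVneq.
  rewrite mul1r -(markov_reads statU visited FE) ?su//; congr (pr _).
  apply/seteqP; split=> o /= [oE].
    by move=> /(again o (Eo o oE))[].
  by move=> ou; split=> //; apply/(again o (Eo o oE)).
rewrite mul0r mulr0 (_ : _ `&` _ = set0) ?measure0//.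
by apply/seteqP; split=> o //= [oE /(again o (Eo o oE))[/eqP]]; rewrite (negbTE wv).
Qed.

(** The events { T_w^(r) = m, w occurs at n } for [m <= n] are disjoint and
    cover { w occurs at n, T_w^(r) <= n }. *)
Lemma renewal r n : (0 < r)%N ->
  late_occ_prob r n = \sum_(m < n.+1) position_prob r m * return_prob (n - m)%N.
Proof.
move=> r0; pose T m := [set o | occ m o /\ N m o = r].
pose H i := [set o | occ n o /\ exists m, (m < i)%N /\ T m o].
have mO : measurable [set o | occ n o].
  exact: filtration_measurable (@filtration_occurs _ _ _ _ U n n w (leqnn n)).
have mT m : measurable (T m) by exact: measurable_position.
have mH i : measurable (H i).
  rewrite (_ : H i = [set o | occ n o] `&` [set o | exists m, (m < i)%N /\ T m o])//.
  apply: measurableI => //; rewrite (_ : [set o | _] = \bigcup_(m in `I_i) T m).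
    by apply: bigcup_measurable => m _.
  by apply/seteqP; split=> o /= [m]; [case=> mi Tm; exists m|move=> mi Tm; exists m].
have partial i : (i <= n.+1)%N ->
    \sum_(m < i) position_prob r m * return_prob (n - m)%N = pr (H i).
  elim: i => [_|i IH lin].
    rewrite big_ord0 (_ : H 0%N = set0) ?measure0//.
    by apply/seteqP; split=> o // [_ [m []]].
  rewrite big_ord_recr /= IH ?(ltnW lin)//.
  rewrite -(return_probE _ (@filtration_position r i)); last by move=> o [].
  rewrite subnKC// -pr_disjointU//.
  - congr (pr _); apply/seteqP; split=> o.
      case=> [[on [m [mi Tm]]]|[Ti on]].
        by split=> //; exists m; split=> //; rewrite ltnW.
      by split=> //; exists i; split.
    case=> on [m [mi Tm]]; move: mi; rewrite ltnS leq_eqVlt => /orP[/eqP mi|mi].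
      by right; split=> //; rewrite -mi.
    by left; split=> //; exists m.
  - exact: (@measurableI _ _ (T i)).
  - move=> o [on [m [mi [om mr]]]] [[oi ir] _].
    by move: mi; rewrite (nb_occ_inj om oi) ?ltnn// mr ir.
rewrite partial//; congr (pr _); apply/seteqP; split=> o /= [on].
  move=> rN; split=> //; have [|m [mn om mr]] := @nb_occ_reach o n r.
    by rewrite r0.
  by exists m.
by case=> m [mn [om <-]]; split=> //; exact: nb_occ_mono.
Qed.

Lemma late_occ_probS r n :
  late_occ_prob r n = position_prob r n + late_occ_prob r.+1 n.
Proof.
rewrite -pr_disjointU.
- congr (pr _); apply/seteqP; split=> o /=.
    by case=> on; rewrite leq_eqVlt => /orP[/eqP->|rN]; [left|right].
  by case=> -[on] => [<-|/ltnW rN].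
- exact: measurable_position.
- exact: measurable_late.
- by move=> o /= [_ ->] []; rewrite ltnn.
Qed.

Lemma late_occ_prob1 n :
  late_occ_prob 1 n = if (k <= n)%N then fine (pi (cylinder w)) else 0.
Proof.
rewrite /late_occ_prob; case: ifPn => kn.
  rewrite -(P_reads_stationary statU w n); congr (pr _); apply/seteqP; split=> o /=.
    by case=> -[].
  move=> on; have oo : occ n o by [].
  split=> //; case: n oo {on kn} => [|n] oo; first by rewrite nb_occ0 asboolT.
  by rewrite nb_occS asboolT// addn1.
rewrite (_ : [set o | _] = set0) ?measure0//.
by apply/seteqP; split=> o //= [[]]; rewrite -/k (negbTE kn).
Qed.

Lemma position_prob01 r n : 0 <= position_prob r n <= 1.
Proof. by apply: pr01; exact: measurable_position. Qed.

Lemma late_occ_prob01 r n : 0 <= late_occ_prob r n <= 1.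
Proof. by apply: pr01; exact: measurable_late. Qed.

Lemma return_prob01 j : 0 <= return_prob j <= 1.
Proof.
rewrite /return_prob; case: ifP => _; first by rewrite ler01 lexx.
case: ifP => _; last exact: (qn01 visited).
by case: eqP => _; rewrite ?mul1r ?mul0r ?lexx ?ler01//; exact: (qn01 visited).
Qed.

(** By [overlap_gt0], a possible return would make [w] itself possible. *)
Lemma return_prob_null j : pi (cylinder w) = 0%E -> (0 < j)%N -> return_prob j = 0.
Proof.
move=> w0 j0; rewrite /return_prob -[_ == _]negbK -lt0n j0 /=.
case: ifPn => [jk|_]; last exact: (qn_eq0 statU).
case: eqP => [wj|_]; last by rewrite mul0r.
rewrite mul1r; apply/eqP; rewrite eq_le.
have [-> _] := andP (qn01 visited j (drop (k - j) w)); rewrite andbT.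
rewrite leNgt; apply/negP => qw.
have := overlap_gt0 statU visited (prefwP wN) _ wj qw.
by rewrite j0 jk (P_reads_stationary statU) w0 ltxx => /(_ isT).
Qed.

Section generating_functions.
Variable x : R[i].
Hypothesis x1 : `|x| < 1.

Lemma Phi_position r :
  Phi U w r x = sum_from 0 (fun n => (position_prob r n)%:C%C * x ^+ n).
Proof.
congr (sum_from 0 _); apply/funext => n; congr ((fine (P _))%:C%C * _).
by apply/seteqP; split=> o /=; rewrite positionE.
Qed.

Lemma Sw_return :
  Sw U w x = sum_from 0 (fun n => (return_prob n)%:C%C * x ^+ n).
Proof.
rewrite (sum_from_split k return_prob01 x1) /Sw /Cw -/k -/c; congr (_ + _).
  rewrite [in RHS]big_ltn// expr0 mulr1 [return_prob 0]/return_prob eqxx rmorph1.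
  congr (_ + _); apply: eq_big_nat => j /andP[j0 jk].
  rewrite /return_prob -[_ == 0%N]negbK -lt0n j0 /= jk [in RHS]rmorphM /=.
  by rewrite rmorph_nat.
apply: eq_sum_from => j kj.
by rewrite /return_prob ltnNge kj -[_ == 0%N]negbK -lt0n (leq_trans k0 kj).
Qed.

Lemma Phi1_mul_Sw :
  Phi U w 1 x * Sw U w x = x ^+ k * (fine (pi (cylinder w)))%:C%C / (1 - x).
Proof.
rewrite Phi_position Sw_return -(@sum_from_cauchy _ _ _ (late_occ_prob 1))//.
- rewrite -sum_from_geometric//; last first.
    by rewrite -(P_reads_stationary statU w 0); apply: pr01; exact: measurable_reads.
  by congr (sum_from 0 _); apply/funext => n; rewrite late_occ_prob1.
- exact: position_prob01.
- exact: return_prob01.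
- by move=> n; rewrite renewal.
Qed.

(** An occurrence that comes at [T_w^(r)] or later is either the [r]-th one or
    comes at [T_w^(r+1)] or later. *)
Lemma Phi_mul_Sw r : (0 < r)%N ->
  Phi U w r x * Sw U w x = Phi U w r x + Phi U w r.+1 x * Sw U w x.
Proof.
move=> r0; rewrite !Phi_position Sw_return.
rewrite -(@sum_from_cauchy _ _ _ (late_occ_prob r))//; last 3 first.
- exact: position_prob01.
- exact: return_prob01.
- by move=> n; rewrite renewal.
rewrite -(@sum_from_cauchy _ _ _ (late_occ_prob r.+1))//; last 3 first.
- exact: position_prob01.
- exact: return_prob01.
- by move=> n; rewrite renewal.
apply: sum_fromD => //.
- exact: position_prob01.
- exact: late_occ_prob01.
- by move=> n; rewrite late_occ_probS.
Qed.

Lemma Sw_neq0 : Sw U w x != 0.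
Proof.
have onex : x != 1 by apply: contraTneq x1 => ->; rewrite normr1 ltxx.
have head : (forall n, (0 < n)%N -> (return_prob n)%:C%C * x ^+ n = 0) ->
    Sw U w x != 0.
  by move=> H; rewrite Sw_return sum_from_head// expr0 mulr1 /return_prob eqxx oner_neq0.
have [w0|w0] := eqVneq (pi (cylinder w)) 0%E.
  by apply: head => n n0; rewrite return_prob_null// mul0r.
have [x0|x0] := eqVneq x 0.
  by apply: head => n n0; rewrite x0 expr0n -[n == _]negbK -lt0n n0 mulr0.
apply: contraTneq isT => S0; have := Phi1_mul_Sw; rewrite S0 mulr0 => /esym/eqP.
rewrite !mulf_eq0 expf_eq0 (negbTE x0) andbF /= invr_eq0 subr_eq0.
rewrite [1 == x]eq_sym (negbTE onex) orbF => /eqP/(@complexI R)/eqP.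
by rewrite fine_eq0 ?(negbTE w0)// fin_num_measure//; exact: measurable_cylinder.
Qed.

End generating_functions.
End occurrences.

Theorem proposition29 (R : realType) (d : measure_display)
    (Omega : measurableType d) (P : probability Omega R)
    (q : context -> probability bool R) (U : nat -> {RV P >-> L})
    (pi : probability L R) (w : seq bool) :
  stationary_vlmc q U pi ->
  (1 <= size w)%N ->
  ~ internal_node (rev w) ->
  P [set o | reads U (rev (leaf (prefw w))) 0 o] != 0%E ->
  forall x : R[i], `|x| < 1 ->
    [/\ Sw U w x != 0,
        Phi U w 1 x
          = x ^+ size w * (fine (pi (cylinder w)))%:C%C / ((1 - x) * Sw U w x) &
        forall r : nat, (1 <= r)%N ->
          Phi U w r x = Phi U w 1 x * (1 - 1 / Sw U w x) ^+ r.-1].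
Proof.
move=> statU w0 wN visited x x1.
have S0 := Sw_neq0 statU w0 wN visited x1.
split=> //.
  by rewrite invfM mulrA -(Phi1_mul_Sw statU w0 wN visited x1) mulfK.
elim=> [//|[|r] IH] _; first by rewrite expr0 mulr1.
rewrite exprSr mulrA -IH// mulrBr mulr1 mul1r; apply: (mulIf S0).
rewrite mulrBl divfK//.
by rewrite (Phi_mul_Sw statU w0 wN visited x1 (ltn0Sn r)) addrC addKr.
Qed.
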